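(* Let $\mathtt D$ be a finite set of Boolean functions $\{0,1\}^d\to\{0,1\}$ and let $\mathtt C$ be the class of $\mathtt D$-CSPs. Then $$\dim_{\mathrm{VC}}\mathtt C\le\dim_h\mathtt C\le|\mathtt D|.$$
   Context: Let $n=2^d$ and identify $[n]=\{0,\dots,n-1\}$ with $\{0,1\}^d$. The conjunction $\bigwedge_i f_i$ of Boolean functions sends $v$ to $1$ iff $f_i(v)=1$ for all $i$ (empty conjunction = constant $1$). The class of $\mathtt D$-CSPs is the set of all conjunctions $\bigwedge_i f_i$ of (finite) families of functions $f_i\in\mathtt D$. Fix a field $\Bbbk$, $S=\Bbbk[x_{(i,b)}: i\in[n], b\in\{0,1\}]$; for a function class $\mathtt C\subseteq\{0,1\}^{[n]}$, $I^\star_{\mathtt C}=\langle\prod_{i\in[n]}x_{(i,1-f(i))}: f\in\mathtt C\rangle$ and $\dim_h\mathtt C:=\operatorname{projdim}_SI^\star_{\mathtt C}$. A set $U\subseteq[n]$ is shattered by $\mathtt C$ if every function $U\to\{0,1\}$ is a restriction of some $f\in\mathtt C$; $\dim_{\mathrm{VC}}\mathtt C$ is the maximal size of a shattered set. *)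

(* Defs.v *)
From HB Require Import structures.
From mathcomp Require Import all_boot all_order all_algebra.
Set Implicit Arguments. Unset Strict Implicit. Unset Printing Implicit Defensive.
Import GRing.Theory.
Local Open Scope ring_scope.

Fixpoint mpoly (R : comNzRingType) (m : nat) : comNzRingType :=
  match m with
  | 0 => R
  | m'.+1 => GRing.ComNzRing.clone _ {poly (mpoly R m')}
  end.

(* The i-th variable (i < m) of mpoly R m; out-of-range indices give 0. *)
Fixpoint mvar (R : comNzRingType) (m : nat) (i : nat) : mpoly R m :=
  match m return mpoly R m with
  | 0 => 0
  | m'.+1 => if i == m' then ('X : {poly mpoly R m'})
             else ((mvar R m' i)%:P : {poly mpoly R m'})
  end.

(* The cube {0,1}^d, identified with [n], n = 2^d (via enum_rank). *)
Definition cube (d : nat) := {ffun 'I_d -> bool}.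
Definition boolfun (d : nat) := {ffun cube d -> bool}.

(* The class of D-CSPs: conjunctions of finite families of functions in D
   (empty conjunction = constant 1).  Since a conjunction only depends on the
   set of functions occurring in the family, the families are taken to be
   subsets E of D. *)
Definition conj_of (d : nat) (E : {set boolfun d}) : boolfun d :=
  [ffun v => [forall g in E, g v]].

Definition CSP (d : nat) (D : {set boolfun d}) : {set boolfun d} :=
  [set f | [exists E : {set boolfun d}, (E \subset D) && (f == conj_of E)]].

Definition shattered (d : nat) (C : {set boolfun d}) (U : {set cube d}) : bool :=
  [forall g : {ffun cube d -> bool},
     [exists f in C, [forall u in U, f u == g u]]].

Definition dimVC (d : nat) (C : {set boolfun d}) : nat :=
  (\max_(U : {set cube d} | shattered C U) #|U|)%N.

(* The polynomial ring S = k[x_(i,b) : i in [n], b in {0,1}], with the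
   variable x_(i,b) being variable number 2*i+b, and i in [n] identified
   with a point of the cube via enum_rank. *)
Definition nvars (d : nat) : nat := (2 * #|cube d|)%N.
Definition Sring (k : fieldType) (d : nat) : comNzRingType := mpoly k (nvars d).

Definition xvar (k : fieldType) (d : nat) (i : cube d) (b : bool) : Sring k d :=
  mvar k (nvars d) (2 * enum_rank i + b)%N.

Definition monom (k : fieldType) (d : nat) (f : boolfun d) : Sring k d :=
  \prod_(i : cube d) xvar k i (~~ f i).

Definition ideal_gen (R : comNzRingType) (T : finType) (P : pred T) (g : T -> R)
  (x : R) : Prop :=
  exists c : T -> R, x = \sum_(t | P t) c t * g t.

Definition Istar (k : fieldType) (d : nat) (C : {set boolfun d}) : Sring k d -> Prop :=
  ideal_gen (mem C) (@monom k d).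

(* Free resolutions (of finite rank) of an ideal I of R of length L:
     0 -> R^(r (L+1)) --F L--> ... --F 1--> R^(r 1) --F 0--> I -> 0
   with maps acting on row vectors, v |-> v *m F j. *)
Definition rk (r : nat -> nat) (j : nat) : nat := if j is 0 then 1%N else r j.

Definition is_free_res (R : comNzRingType) (I : R -> Prop) (L : nat)
  (r : nat -> nat) (F : forall j, 'M[R]_(r j.+1, rk r j)) : Prop :=
  [/\ (forall x : R, I x <-> exists v : 'rV[R]_(r 1%N), (v *m F 0%N) ord0 ord0 = x),
      (forall j, (j < L)%N -> forall v : 'rV[R]_(r j.+1),
          v *m F j = 0 <-> exists w : 'rV[R]_(r j.+2), v = w *m F j.+1)
    & (forall v : 'rV[R]_(r L.+1), v *m F L = 0 -> v = 0)].

Definition projdim_le (R : comNzRingType) (I : R -> Prop) (L : nat) : Prop :=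
  exists (r : nat -> nat) (F : forall j, 'M[R]_(r j.+1, rk r j)), is_free_res I L F.

Arguments Istar k {d} C _.

(* Main.v *)
Require Import Defs.
From HB Require Import structures.
From mathcomp Require Import all_boot all_order all_algebra.
From mathcomp Require Import zify.

(** Upper bound.  Label the vertex [E] of the cube [powerset D] with the set of
    variables of the generator given by the conjunction of [E].  If [E1] is
    included in [E] and [E] in [E1 :|: E2], the generator of [E] divides the lcm
    of those of [E1] and [E2].  Splitting the cube along one [f] in [D] writes the
    ideal as [I + J], where [I], [J] and their intersection are ideals of the same
    kind for [D :\ f]; the mapping cone of [I ∩ J -> I ⊕ J] then adds one to the
    length of the resolution.

    Lower bound.  If [U] is shattered, then [c J ⊆ I* ⊆ J], where [J] is the
    product over [u] in [U] of the ideals [(x_(u,0), x_(u,1))] and [c] is the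
    product of the variables outside [U].  Iterated cones give a resolution of [J]
    of length [#|U|] whose later maps vanish under the evaluation [eps] sending the
    variables over [U] to [0] and all others to [1].  A resolution of [I*] of
    length below [#|U|] would, by comparison up to the factor [c], make the
    multiplication by [c] on the last module of the resolution of [J] factor
    through its last map, hence [eps c = 0], whereas [eps c = 1]. *)

Set Implicit Arguments. Unset Strict Implicit. Unset Printing Implicit Defensive.
Import GRing.Theory.
Local Open Scope ring_scope.

(** * Free resolutions and mapping cones *)

Definition mx_inj (R : comNzRingType) m n (A : 'M[R]_(m, n)) :=
  forall v : 'rV_m, v *m A = 0 -> v = 0.

Definition exact_mx (R : comNzRingType) p m n (B : 'M[R]_(p, m))
  (A : 'M[R]_(m, n)) :=
  forall v : 'rV_m, v *m A = 0 <-> exists w, v = w *m B.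

(** Recursive form of [is_free_res]: [A] is continued by [L] further maps, the last one injective.
    This makes induction on the length possible. *)
Fixpoint resolvable (R : comNzRingType) L m n (A : 'M[R]_(m, n)) : Prop :=
  if L is L'.+1 then
    exists p (B : 'M[R]_(p, m)), exact_mx B A /\ resolvable L' B
  else mx_inj A.

Definition mx_spans (R : comNzRingType) (I : R -> Prop) m (A : 'M[R]_(m, 1)) :=
  forall x, I x <-> exists v : 'rV_m, v *m A = x%:M.

Definition idealres (R : comNzRingType) L (I : R -> Prop) :=
  exists m (A : 'M[R]_(m, 1)), mx_spans I A /\ resolvable L A.

Lemma mx11P (R : comNzRingType) (A : 'M[R]_1) x : A ord0 ord0 = x <-> A = x%:M.
Proof.
split=> [<-|->]; last by rewrite mxE eqxx mulr1n.
exact: mx11_scalar.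
Qed.

Lemma scalar_mx11_inj (R : comNzRingType) (a b : R) :
  a%:M = b%:M :> 'M_1 -> a = b.
Proof. by move=> /matrixP/(_ ord0 ord0); rewrite !mxE eqxx. Qed.

Lemma lift_rows (R : comNzRingType) p m q (B : 'M[R]_(p, m)) (M : 'M[R]_(q, m)) :
  (forall i, exists w, row i M = w *m B) -> exists X, M = X *m B.
Proof.
move=> /fin_all_exists[f fP]; exists (\matrix_i f i).
by apply/row_matrixP=> i; rewrite row_mul rowK.
Qed.

Lemma exact_lift (R : comNzRingType) p m n q (B : 'M[R]_(p, m))
    (A : 'M[R]_(m, n)) (M : 'M[R]_(q, m)) :
  exact_mx B A -> M *m A = 0 -> exists X, M = X *m B.
Proof.
move=> BA MA; apply: lift_rows => i; apply/BA.
by rewrite -row_mul MA row0.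
Qed.

Lemma exact_mul0 (R : comNzRingType) p m n (B : 'M[R]_(p, m)) (A : 'M[R]_(m, n)) :
  exact_mx B A -> B *m A = 0.
Proof.
move=> BA; apply/row_matrixP=> i; rewrite row_mul row0; apply/BA.
by exists (delta_mx 0 i); rewrite rowE.
Qed.

Lemma mx_inj_mul0 (R : comNzRingType) m n q (A : 'M[R]_(m, n)) (M : 'M[R]_(q, m)) :
  mx_inj A -> M *m A = 0 -> M = 0.
Proof.
by move=> Ai MA; apply/row_matrixP=> i; rewrite row0; apply: Ai; rewrite -row_mul MA row0.
Qed.

Lemma exact_inj (R : comNzRingType) m n (A : 'M[R]_(m, n)) :
  mx_inj A -> exact_mx (0 : 'M[R]_(0, m)) A.
Proof.
move=> Ai v; split=> [/Ai->|[w ->]]; last by rewrite mulmx0 mul0mx.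
by exists 0; rewrite mulmx0.
Qed.

Lemma resolvableS (R : comNzRingType) L m n (A : 'M[R]_(m, n)) :
  resolvable L A -> resolvable L.+1 A.
Proof.
elim: L m n A => [|L IH] m n A.
  move=> /= /exact_inj A0; exists 0%N, 0; split=> // v _.
  by apply/matrixP=> i [].
by move=> [p [B [BA /IH Bres]]]; exists p, B.
Qed.

Lemma resolvable_leq (R : comNzRingType) L L' m n (A : 'M[R]_(m, n)) :
  (L <= L')%N -> resolvable L A -> resolvable L' A.
Proof.
move=> /subnK <-; elim: (L' - L)%N => [|j IH] Ares //.
by rewrite addSn; apply/resolvableS/IH.
Qed.

(** Only the kernel of the first map matters to its continuation, so block columns can be added or
    dropped as long as the kernel stays the same. *)
Lemma resolvable_ker (R : comNzRingType) L m n n' (A : 'M[R]_(m, n))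
    (A' : 'M[R]_(m, n')) :
  (forall v : 'rV_m, v *m A = 0 <-> v *m A' = 0) ->
  resolvable L A -> resolvable L A'.
Proof.
move=> AA'; case: L => [|L] /=; first by move=> Ai v /AA'/Ai.
by move=> [p [B [BA Bres]]]; exists p, B; split=> // v; rewrite -AA'.
Qed.

Lemma resolvable_tail (R : comNzRingType) L m n (A : 'M[R]_(m, n)) :
  resolvable L A ->
  exists (r : nat -> nat) (F : forall j, 'M[R]_(r j, if j is j'.+1 then r j' else m)),
  [/\ L = 0%N -> mx_inj A,
      (0 < L)%N -> exact_mx (F 0%N) A /\
        forall j, (j.+1 < L)%N -> exact_mx (F j.+1) (F j)
    & forall j, (j.+1 = L)%N -> mx_inj (F j)].
Proof.
elim: L m n A => [|L IH] m n A /=.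
  by move=> Ai; exists (fun=> 0%N), (fun j => 0).
move=> [p [B [BA /IH[r [F [F0 FS FL]]]]]].
pose r' j := if j is j'.+1 then r j' else p.
exists r', (fun j =>
  match j return 'M[R]_(r' j, if j is j'.+1 then r' j' else m) with
  | 0 => B | j'.+1 => F j' end); split=> //.
  move=> _; split=> // -[|j] jL; first by have [] := FS jL.
  have L0 : (0 < L)%N by lia.
  by apply: (FS L0).2.
by move=> [|j] [jL]; [apply: F0|apply: FL].
Qed.

Lemma projdim_resolvable (R : comNzRingType) (I : R -> Prop) L :
  projdim_le I L <-> idealres L I.
Proof.
split=> [[r [F [F0 FS FL]]]|[m [A [AI Ares]]]].
  exists (r 1%N), (F 0%N); split.
    by move=> x; rewrite F0; split=> -[v /mx11P vx]; exists v.
  suff: forall j i, (i + j = L)%N -> resolvable j (F i) by apply; apply: add0n.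
  elim=> [|j IH] i; first by rewrite addn0 => ->.
  move=> iL; exists (r i.+2), (F i.+1); split; first by apply: FS; lia.
  by apply: IH; rewrite addSnnS.
have [r [F [F0 FS FL]]] := resolvable_tail Ares.
(* Ranks are shifted by one: [rk] already puts rank 1 at position 0, so [m] sits at position 1. *)
pose r' j := if j is j'.+1 then if j' is i.+1 then r i else m else 0%N.
exists r', (fun j => match j return 'M[R]_(r' j.+1, rk r' j) with
  | 0 => A | j'.+1 => F j' end); split.
- by move=> x; rewrite AI; split=> -[v /mx11P vx]; exists v.
- move=> [|j] jL; first by case: (FS jL).
  have L0 : (0 < L)%N by lia.
  by apply: (FS L0).2.
- by case: (L) F0 FL => [|j] F0 FL; [apply: F0|apply: FL].
Qed.

(** The square of [g] and [g2] anticommutes, which replaces the sign in the usual cone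
    differential. *)
Lemma cone_exact (R : comNzRingType) p2 p q m2 m n (P2 : 'M[R]_(p2, p))
    (P : 'M[R]_(p, q)) (Q2 : 'M[R]_(m2, m)) (Q : 'M[R]_(m, n)) g g2 :
  exact_mx P2 P -> exact_mx Q2 Q -> g2 *m Q + P2 *m g = 0 ->
  exact_mx (block_mx Q2 0 g2 P2) (block_mx Q 0 g P).
Proof.
move=> PE QE gg; rewrite /exact_mx => v; split; last first.
  move=> [w ->]; rewrite -mulmxA mulmx_block !mulmx0 !mul0mx !add0r gg.
  by rewrite (exact_mul0 PE) (exact_mul0 QE) addr0 block_mx0 mulmx0.
rewrite -[v]hsubmxK; set a := lsubmx v; set b := rsubmx v.
rewrite mul_row_block mulmx0 add0r => /eqP; rewrite row_mx_eq0 => /andP[/eqP e1 /eqP].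
(* Once [b = c *m P2], subtracting [c *m g2] from [a] moves it into the kernel of [Q]. *)
move=> /PE[c bE]; have /QE[e aE] : (a - c *m g2) *m Q = 0.
  rewrite mulmxBl -mulmxA (_ : g2 *m Q = - (P2 *m g)); last first.
    by apply/eqP; rewrite -subr_eq0 opprK gg.
  by rewrite mulmxN opprK mulmxA -bE.
exists (row_mx e c); rewrite mul_row_block mulmx0 add0r -aE -bE.
by rewrite subrK.
Qed.

Lemma exact_diag (R : comNzRingType) p2 p q m2 m n (P2 : 'M[R]_(p2, p))
    (P : 'M[R]_(p, q)) (Q2 : 'M[R]_(m2, m)) (Q : 'M[R]_(m, n)) :
  exact_mx P2 P -> exact_mx Q2 Q ->
  exact_mx (block_mx Q2 0 0 P2) (block_mx Q 0 0 P).
Proof. by move=> PE QE; apply: cone_exact => //; rewrite mul0mx mulmx0 addr0. Qed.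

(* The maps of the mapping cone of a chain map from a resolution continuing [P]
   to one continuing [Q]: the hypothesis on [g] is what allows it to be lifted. *)
Lemma resolvable_cone (R : comNzRingType) L p q m n (P : 'M[R]_(p, q))
    (Q : 'M[R]_(m, n)) g :
  (forall v : 'rV_p, v *m P = 0 -> exists w, v *m g = w *m Q) ->
  resolvable L P -> resolvable L Q -> resolvable L (block_mx Q 0 g P).
Proof.
elim: L p q m n P Q g => [|L IH] p q m n P Q g gP.
  move=> /= Pi Qi v; rewrite -[v]hsubmxK mul_row_block mulmx0 add0r => /eqP.
  rewrite row_mx_eq0 => /andP[/eqP e1 /eqP/Pi e2]; move: e1.
  by rewrite e2 mul0mx addr0 => /Qi ->; rewrite row_mx0.
move=> [p2 [P2 [PE P2res]]] [m2 [Q2 [QE Q2res]]].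
have [g2 g2E] : exists X, - (P2 *m g) = X *m Q.
  apply: lift_rows => i; rewrite linearN /= row_mul.
  case: (gP (row i P2)); first by rewrite -row_mul (exact_mul0 PE) row0.
  by move=> w ->; exists (- w); rewrite mulNmx.
exists (m2 + p2)%N, (block_mx Q2 0 g2 P2); split.
  by apply: cone_exact => //; rewrite -g2E addNr.
apply: IH => // v vP2; apply/QE.
by rewrite -mulmxA -g2E mulmxN mulmxA vP2 mul0mx oppr0.
Qed.

Lemma resolvable_diag (R : comNzRingType) L p q m n (P : 'M[R]_(p, q))
    (Q : 'M[R]_(m, n)) :
  resolvable L P -> resolvable L Q -> resolvable L (block_mx Q 0 0 P).
Proof.
by apply: resolvable_cone => v _; exists 0; rewrite mulmx0 mul0mx.
Qed.

Lemma spans_lift (R : comNzRingType) (I J : R -> Prop) p m (A : 'M[R]_(p, 1))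
  (B : 'M[R]_(m, 1)) : mx_spans I A -> mx_spans J B -> (forall x, I x -> J x) ->
  exists X, A = X *m B.
Proof.
move=> IA JB IJ; apply: lift_rows => i.
have [w Ew] : exists v : 'rV_m, v *m B = (row i A ord0 ord0)%:M.
  apply/JB/IJ/IA; exists (delta_mx 0 i); rewrite -rowE; exact/mx11P.
by exists w; rewrite Ew; apply/mx11P.
Qed.

(* Mapping cone of [I ∩ J -> I ⊕ J], whose cokernel is [I + J]. *)
Lemma idealres_sum (R : comNzRingType) L (I J : R -> Prop) :
  idealres L I -> idealres L J -> idealres L (fun x => I x /\ J x) ->
  idealres L.+1 (fun x => exists y z, [/\ I y, J z & x = y + z]).
Proof.
(* Padding to length [L.+1] provides first syzygies [A2] and [B2] even when [L] is 0. *)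
move=> [m [A [IA /resolvableS[m2 [A2 [AE A2res]]]]]].
move=> [n [B [JB /resolvableS[n2 [B2 [BE B2res]]]]]] [p [P [IJP Pres]]].
have [gA PA] := spans_lift IJP IA (fun x => @proj1 _ _).
have [gB PB] := spans_lift IJP JB (fun x => @proj2 _ _).
exists (m + n)%N, (col_mx A B); split.
  move=> x; split.
    move=> [y [z [/IA[v vE] /JB[w wE] ->]]]; exists (row_mx v w).
    by rewrite mul_row_col vE wE raddfD.
  move=> [v]; rewrite -[v]hsubmxK mul_row_col => vE.
  exists ((lsubmx v *m A) ord0 ord0), ((rsubmx v *m B) ord0 ord0); split.
  - by apply/IA; exists (lsubmx v); apply/mx11P.
  - by apply/JB; exists (rsubmx v); apply/mx11P.
  by move/mx11P: vE => <-; rewrite mxE.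
(* [g] lifts [z |-> (z, -z)], the embedding of the intersection as the kernel of the sum map. *)
set Q := block_mx A2 0 0 B2; set g := row_mx gA (- gB).
have gE (v : 'rV_p) : v *m P = 0 -> exists w, v *m g = w *m Q.
  move=> vP; have /AE[a aE] : v *m gA *m A = 0 by rewrite -mulmxA -PA.
  have /BE[b bE] : v *m gB *m B = 0 by rewrite -mulmxA -PB.
  exists (row_mx a (- b)); rewrite mul_row_block !mulmx0 add0r addr0.
  by rewrite mulNmx -aE -bE mul_mx_row mulmxN.
exists (m2 + n2 + p)%N, (col_mx Q g); split.
  move=> v; rewrite -[v]hsubmxK; set a := lsubmx v; set b := rsubmx v.
  rewrite mul_row_col; split.
    (* A syzygy [(a, b)] yields the common element [a *m A = - (b *m B)] of [I] and [J]; removing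
       its lift [c *m g] leaves separate syzygies of [A] and [B]. *)
    move=> ab; have : I ((a *m A) ord0 ord0) /\ J ((a *m A) ord0 ord0).
      split; first by apply/IA; exists a; apply/mx11P.
      apply/JB; exists (- b); rewrite mulNmx.
      by rewrite (_ : - (b *m B) = a *m A); [apply/mx11P|apply/esym/eqP; rewrite -addr_eq0 ab].
    move=> /IJP[c]; move=> /esym; rewrite -mx11_scalar => cE.
    have /AE[a' aE] : (a - c *m gA) *m A = 0.
      by rewrite mulmxBl -mulmxA -PA cE subrr.
    have /BE[b' bE] : (b + c *m gB) *m B = 0.
      by rewrite mulmxDl -mulmxA -PB -cE addrC.
    exists (row_mx (row_mx a' b') c); rewrite mul_row_col /Q /g mul_row_block.
    rewrite !mulmx0 add0r addr0 -aE -bE mul_mx_row add_row_mx mulmxN subrK.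
    by rewrite addrK.
  move=> [w]; rewrite -[w]hsubmxK -[lsubmx w]hsubmxK.
  rewrite mul_row_col /Q /g mul_row_block mul_mx_row add_row_mx !mulmx0 add0r addr0.
  move=> /eq_row_mx[-> ->]; rewrite !mulmxDl -!mulmxA (exact_mul0 AE) (exact_mul0 BE).
  by rewrite !mulmx0 !add0r mulNmx -PB -PA mulmxN subrr.
(* The cone has the additional block column [(0, P)]. The kernel is unchanged: multiplying
   [v *m col_mx Q g = 0] by [col_mx A 0] shows that [P] kills the last block of [v]. *)
apply: (resolvable_ker _ (resolvable_cone gE Pres (resolvable_diag B2res A2res))).
move=> v; rewrite block_mxEh mul_mx_row; split.
  by move=> /eqP; rewrite row_mx_eq0 => /andP[/eqP].
move=> vQ; rewrite vQ; apply/eqP; rewrite row_mx_eq0 eqxx /=; apply/eqP.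
move: vQ; rewrite -[v]hsubmxK !mul_row_col mulmx0 add0r.
move=> /(congr1 (mulmx^~ (col_mx A 0))) /=.
rewrite mul0mx mulmxDl -!mulmxA mul_block_col mul_row_col (exact_mul0 AE) -PA.
by rewrite !mulmx0 !mul0mx !addr0 col_mx0 mulmx0 add0r.
Qed.

(** * Monomial ideals *)

(** Exponents are total functions on [nat], read only below [m]; predicates on them therefore come
    with [local_pred]. *)
Fixpoint mcoef (R : comNzRingType) m : mpoly R m -> (nat -> nat) -> R :=
  match m return mpoly R m -> (nat -> nat) -> R with
  | 0 => fun p _ => p
  | m'.+1 => fun p e => mcoef (p : {poly mpoly R m'})`_(e m') e
  end.

Lemma mcoef_ext (R : comNzRingType) m (p : mpoly R m) e e' :
  (forall i, (i < m)%N -> e i = e' i) -> mcoef p e = mcoef p e'.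
Proof.
elim: m p => [|m IH] p ee' //=; rewrite ee' //; apply: IH => i im.
by apply: ee'; rewrite ltnS ltnW.
Qed.

Lemma mcoef0 (R : comNzRingType) m e : mcoef (0 : mpoly R m) e = 0.
Proof. by elim: m => [|m IH] //=; rewrite coef0. Qed.

Lemma mcoefD (R : comNzRingType) m (p q : mpoly R m) e :
  mcoef (p + q) e = mcoef p e + mcoef q e.
Proof. by elim: m p q => [|m IH] p q //=; rewrite coefD IH. Qed.

Lemma mcoefN (R : comNzRingType) m (p : mpoly R m) e : mcoef (- p) e = - mcoef p e.
Proof. by elim: m p => [|m IH] p //=; rewrite coefN IH. Qed.

Lemma mcoefP (R : comNzRingType) m (p q : mpoly R m) :
  (forall e, mcoef p e = mcoef q e) -> p = q.
Proof.
elim: m p q => [|m IH] p q pq; first exact: (pq (fun=> 0%N)).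
apply/polyP => j; apply: IH => e.
have:= pq (fun i => if i == m then j else e i); rewrite /= eqxx => E.
set e' := (fun i => _) in E.
have ee' i : (i < m)%N -> e i = e' i by rewrite /e'; case: eqP => // ->; rewrite ltnn.
by rewrite !(mcoef_ext _ ee').
Qed.

Lemma mcoefX (R : comNzRingType) m i (p : mpoly R m) e : (i < m)%N ->
  mcoef (mvar R m i * p) e =
  if (0 < e i)%N then mcoef p (fun j => e j - (j == i))%N else 0.
Proof.
elim: m p => [|m IH] //= p; rewrite ltnS leq_eqVlt.
case: eqP => [-> _|_ /= im].
  rewrite coefXM eqxx subn1; case: (e m) => [|n] /=; first by rewrite mcoef0.
  by apply: mcoef_ext => j jm; rewrite ltn_eqF // subn0.
rewrite coefCM IH // gtn_eqF // subn0.
by case: ifP.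
Qed.

(** Keeps the terms whose exponent satisfies [Q]. Passing to the coefficient of degree [j] freezes
    coordinate [m'] at [j]; with no coordinate left, a local [Q] can be tested at 0. *)
Fixpoint mtrunc (R : comNzRingType) m : ((nat -> nat) -> bool) -> mpoly R m -> mpoly R m :=
  match m return ((nat -> nat) -> bool) -> mpoly R m -> mpoly R m with
  | 0 => fun Q p => if Q (fun=> 0%N) then p else 0
  | m'.+1 => fun Q (p : {poly mpoly R m'}) =>
     \poly_(j < size p) mtrunc (fun e => Q (fun i => if i == m' then j else e i)) p`_j
  end.

Definition local_pred m (Q : (nat -> nat) -> bool) :=
  forall e e', (forall i, (i < m)%N -> e i = e' i) -> Q e = Q e'.

Lemma mcoef_trunc (R : comNzRingType) m Q (p : mpoly R m) e : local_pred m Q ->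
  mcoef (mtrunc Q p) e = if Q e then mcoef p e else 0.
Proof.
elim: m Q p => [|m IH] Q p QP /=; first by rewrite (QP e (fun=> 0%N)).
rewrite coef_poly; case: ltnP => [_|/(nth_default 0) ->]; last first.
  by rewrite mcoef0 if_same.
rewrite IH; last first.
  by move=> e1 e2 e12; apply: QP => i; case: eqP => // ne im; apply: e12; lia.
by rewrite (QP _ e) // => i; case: eqP => [->|].
Qed.

(** Quotient of the division by variable [i]; the terms free of that variable are dropped. *)
Fixpoint mdiv (R : comNzRingType) m i : mpoly R m -> mpoly R m :=
  match m return mpoly R m -> mpoly R m with
  | 0 => id
  | m'.+1 => fun p : {poly mpoly R m'} =>
     if i == m' then \poly_(j < size p) p`_j.+1
     else \poly_(j < size p) mdiv i p`_j
  end.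

Lemma mcoef_div (R : comNzRingType) m i (p : mpoly R m) e : (i < m)%N ->
  mcoef (mdiv i p) e = mcoef p (fun j => e j + (j == i))%N.
Proof.
elim: m p => [|m IH] //= p; rewrite ltnS leq_eqVlt.
case: eqP => [-> _|_ /= im].
  rewrite eqxx addn1 coef_poly; case: ltnP => [_|sz]; last first.
    by rewrite mcoef0 nth_default ?mcoef0 // ltnW.
  by apply: mcoef_ext => j jm; rewrite ltn_eqF // addn0.
rewrite coef_poly gtn_eqF // addn0; case: ltnP => [_|sz]; last first.
  by rewrite nth_default // !mcoef0.
exact: IH.
Qed.

Lemma mdivK (R : comNzRingType) m i (p : mpoly R m) : (i < m)%N ->
  (forall e, mcoef p e != 0 -> (0 < e i)%N) -> p = mvar R m i * mdiv i p.
Proof.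
move=> im pe; apply: mcoefP => e; rewrite mcoefX // mcoef_div //.
case: (posnP (e i)) => ei /=.
  by apply/eqP/negPn/negP => /pe; rewrite ei.
by apply: mcoef_ext => j _; case: eqP => [->|_] /=; lia.
Qed.

Lemma mvar_reg (R : comNzRingType) m i (p : mpoly R m) : (i < m)%N ->
  mvar R m i * p = 0 -> p = 0.
Proof.
move=> im xp; apply: mcoefP => e.
have := congr1 (fun q => mcoef q (fun j => e j + (j == i))%N) xp.
rewrite mcoefX // mcoef0 eqxx addn1 /= mcoef0 => <-.
by apply: mcoef_ext => j _; rewrite addnK.
Qed.

Lemma mcoef_prod (R : comNzRingType) m (s : seq nat) (p : mpoly R m) e :
  uniq s -> (forall i, i \in s -> i < m)%N ->
  mcoef ((\prod_(i <- s) mvar R m i) * p) e =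
  if all (fun i => 0 < e i)%N s then mcoef p (fun j => e j - (j \in s))%N else 0.
Proof.
elim: s e => [|i s IH] e /=.
  by rewrite big_nil mul1r => _ _; apply: mcoef_ext => j _; rewrite subn0.
move=> /andP[nis us] sm; rewrite big_cons -mulrA mcoefX ?sm ?mem_head //.
case: ltnP => //= _; rewrite IH //; last by move=> j js; rewrite sm // in_cons js orbT.
rewrite (@eq_in_all _ _ (fun i => 0 < e i)%N); last first.
  by move=> j js; case: eqP nis => [<-|_ _]; rewrite ?js ?subn0.
case: ifP => // _; apply: mcoef_ext => j _; rewrite in_cons.
by case: eqP nis => [->/negPf ->|] //=; rewrite ?subn0.
Qed.

Lemma mprod_reg (R : comNzRingType) m (s : seq nat) (p : mpoly R m) :
  (forall i, i \in s -> i < m)%N -> (\prod_(i <- s) mvar R m i) * p = 0 -> p = 0.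
Proof.
elim: s => [|i s IH] sm; first by rewrite big_nil mul1r.
rewrite big_cons -mulrA => /mvar_reg E; apply: IH.
  by move=> j js; rewrite sm // in_cons js orbT.
by apply: E; rewrite sm // mem_head.
Qed.

(* The monomial ideal spanned by the monomials whose exponent lies in [Q]
   (an ideal only when [Q] is upward closed). *)
Definition mideal (R : comNzRingType) m (Q : (nat -> nat) -> bool) (p : mpoly R m) :=
  forall e, mcoef p e != 0 -> Q e.

Lemma midealD (R : comNzRingType) m Q (p q : mpoly R m) :
  mideal Q p -> mideal Q q -> mideal Q (p + q).
Proof.
move=> Ip Iq e; rewrite mcoefD; case: (eqVneq (mcoef p e) 0) => [->|/Ip] //.
by rewrite add0r => /Iq.
Qed.

Lemma mideal0 (R : comNzRingType) m Q : mideal Q (0 : mpoly R m).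
Proof. by move=> e; rewrite mcoef0 eqxx. Qed.

Lemma mideal_prod (R : comNzRingType) m (s : seq nat) (p : mpoly R m) :
  uniq s -> (forall i, i \in s -> i < m)%N ->
  mideal (fun e => all (fun i => 0 < e i)%N s) p <->
  exists q, p = (\prod_(i <- s) mvar R m i) * q.
Proof.
move=> us sm; split; last first.
  by move=> [q ->] e; rewrite mcoef_prod //; case: ifP => //; rewrite eqxx.
elim: s us sm p => [|i s IH] /=.
  by move=> _ _ p; exists p; rewrite big_nil mul1r.
move=> /andP[nis us] sm p Ip.
have im : (i < m)%N by rewrite sm // mem_head.
have pE : p = mvar R m i * mdiv i p by apply: mdivK => // e /Ip/andP[].
have [||q qE] := IH us _ (mdiv i p).
- by move=> j js; rewrite sm // in_cons js orbT.
- move=> e; rewrite mcoef_div // => /Ip/andP[_ /allP es].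
  apply/allP => j js; have:= es _ js.
  by case: eqP nis => [<-|]; rewrite ?js ?addn0.
by exists q; rewrite pE qE big_cons mulrA.
Qed.

(** Sums of monomial ideals are disjunctions of exponent predicates: the terms satisfying [Q1] are
    truncated off, and the remaining ones satisfy [Q2]. *)
Lemma mideal_or (R : comNzRingType) m Q1 Q2 (p : mpoly R m) :
  local_pred m Q1 ->
  mideal (fun e => Q1 e || Q2 e) p <->
  exists p1 p2, [/\ mideal Q1 p1, mideal Q2 p2 & p = p1 + p2].
Proof.
move=> Q1P; split; last first.
  by move=> [p1 [p2 [I1 I2 ->]]]; apply: midealD => e; [move/I1 => ->|move/I2 ->; rewrite orbT].
move=> Ip; exists (mtrunc Q1 p), (p - mtrunc Q1 p); split.
- by move=> e; rewrite mcoef_trunc //; case: ifP => //; rewrite eqxx.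
- move=> e; rewrite mcoefD mcoefN mcoef_trunc //.
  by case: ifP => [_|Q1e]; rewrite ?subrr ?eqxx // subr0 => /Ip; rewrite Q1e.
by rewrite addrC subrK.
Qed.

(** * The cubical resolution *)

Lemma idealres_eq (R : comNzRingType) L (I J : R -> Prop) :
  (forall x, I x <-> J x) -> idealres L I -> idealres L J.
Proof.
move=> IJ [m [A [AI Ares]]]; exists m, A; split=> // x.
by rewrite -IJ; apply: AI.
Qed.

Lemma mideal_sub (R : comNzRingType) m (Q1 Q2 : (nat -> nat) -> bool) (p : mpoly R m) :
  (forall e, Q1 e -> Q2 e) -> mideal Q1 p -> mideal Q2 p.
Proof. by move=> Q12 Ip e /Ip/Q12. Qed.

Definition mset_dvd m (A : {set 'I_m}) (e : nat -> nat) := [forall j in A, 0 < e j]%N.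

Lemma mset_dvdP m (A : {set 'I_m}) (e : nat -> nat) :
  reflect (forall j : 'I_m, j \in A -> (0 < e j)%N) (mset_dvd A e).
Proof. exact: forall_inP. Qed.

Lemma mset_dvd_local m (A : {set 'I_m}) : local_pred m (mset_dvd A).
Proof. by move=> e e' ee'; apply: eq_forallb => j; rewrite ee'. Qed.

Lemma mset_dvdU m (A B : {set 'I_m}) e :
  mset_dvd (A :|: B) e = mset_dvd A e && mset_dvd B e.
Proof.
apply/mset_dvdP/andP => [AB|[/mset_dvdP Ae /mset_dvdP Be] j].
  by split; apply/mset_dvdP => j jA; apply: AB; rewrite inE jA ?orbT.
by rewrite inE => /orP[/Ae|/Be].
Qed.

Lemma mset_dvd_sub m (A B : {set 'I_m}) e :
  A \subset B -> mset_dvd B e -> mset_dvd A e.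
Proof. by move=> /subsetP AB /mset_dvdP Be; apply/mset_dvdP => j /AB/Be. Qed.

Definition mmonom (R : comNzRingType) m (A : {set 'I_m}) : mpoly R m :=
  \prod_(i in A) mvar R m i.

Lemma mmonomE (R : comNzRingType) m (A : {set 'I_m}) :
  mmonom R A = \prod_(i <- map val (enum A)) mvar R m i.
Proof. by rewrite /mmonom big_map big_enum. Qed.

Lemma enum_val_uniq m (A : {set 'I_m}) : uniq (map val (enum A)).
Proof. by rewrite map_inj_uniq ?enum_uniq //; apply: val_inj. Qed.

Lemma enum_val_lt m (A : {set 'I_m}) i : i \in map val (enum A) -> (i < m)%N.
Proof. by move=> /mapP[j _ ->]; apply: ltn_ord. Qed.

Lemma mset_dvdE m (A : {set 'I_m}) e :
  mset_dvd A e = all (fun i => 0 < e i)%N (map val (enum A)).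
Proof.
rewrite all_map; apply/mset_dvdP/allP => Ae j; first by rewrite mem_enum => /Ae.
by move=> jA; apply: Ae; rewrite mem_enum.
Qed.

Lemma mideal_mmonom (R : comNzRingType) m (A : {set 'I_m}) (p : mpoly R m) :
  mideal (mset_dvd A) p <-> exists q, p = mmonom R A * q.
Proof.
rewrite mmonomE -(mideal_prod _ (enum_val_uniq A) (@enum_val_lt _ A)).
by split; apply: mideal_sub => e; rewrite mset_dvdE.
Qed.

(** A monomial is a nonzerodivisor, so the principal ideal is free of rank one. *)
Lemma idealres_mmonom (R : comNzRingType) m (A : {set 'I_m}) :
  idealres 0 (mideal (mset_dvd A) : mpoly R m -> Prop).
Proof.
exists 1%N, (mmonom R A)%:M; split.
  move=> x; rewrite mideal_mmonom; split=> [[q ->]|[v]].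
    by exists q%:M; rewrite -scalar_mxM mulrC.
  rewrite [v]mx11_scalar -scalar_mxM => /scalar_mx11_inj <-.
  by exists (v ord0 ord0); rewrite mulrC.
move=> /= v; rewrite [v]mx11_scalar -scalar_mxM -(raddf0 (@scalar_mx _ 1)) => /scalar_mx11_inj.
by rewrite mulrC mmonomE => /(mprod_reg (@enum_val_lt _ A)) ->.
Qed.

Definition label_dvd (T : finType) m (D : {set T}) (W : {set T} -> {set 'I_m}) e :=
  [exists E : {set T}, (E \subset D) && mset_dvd (W E) e].

Lemma label_dvdP (T : finType) m (D : {set T}) (W : {set T} -> {set 'I_m}) e :
  reflect (exists2 E : {set T}, E \subset D & mset_dvd (W E) e) (label_dvd D W e).
Proof. exact: exists_inP. Qed.

Lemma label_dvd_local (T : finType) m (D : {set T}) (W : {set T} -> {set 'I_m}) :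
  local_pred m (label_dvd D W).
Proof. by move=> e e' ee'; apply: eq_existsb => E; rewrite (mset_dvd_local _ ee'). Qed.

(* This compatibility of the vertex labels makes every face of the cube
   [powerset D] contribute one generator of a cellular resolution. *)
Definition convex_label (T : finType) m (W : {set T} -> {set 'I_m}) :=
  forall E1 E E2 : {set T}, E1 \subset E -> E \subset E1 :|: E2 ->
    W E \subset W E1 :|: W E2.

(** The labeling is arbitrary because the induction passes from [W] to [Wf] and to the pointwise
    union of the two. *)
Lemma idealres_label (T : finType) (R : comNzRingType) m (D : {set T})
    (W : {set T} -> {set 'I_m}) :
  convex_label W -> idealres #|D| (mideal (label_dvd D W) : mpoly R m -> Prop).
Proof.
move: {2}#|D| (erefl #|D|) => N; elim: N D W => [|N IH] D W DN Wc.
  rewrite DN; move/eqP: DN; rewrite cards_eq0 => /eqP ->.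
  apply: (idealres_eq _ (idealres_mmonom R (W set0))) => p.
  split; apply: mideal_sub => e.
    by move=> We; apply/label_dvdP; exists set0.
  by move=> /label_dvdP[E]; rewrite subset0 => /eqP ->.
have [f fD] : exists f, f \in D by apply/card_gt0P; rewrite DN.
pose D' := D :\ f; pose Wf E := W (f |: E).
have D'N : #|D'| = N by apply/eqP; rewrite -eqSS -DN (cardsD1 f D) fD.
have Wfc : convex_label Wf.
  move=> E1 E E2 E1E EE12; apply: Wc; first exact: setUS.
  by apply: subset_trans (setUS _ EE12) _; rewrite -setUUr.
have Wlc : convex_label (fun E => W E :|: Wf E).
  move=> E1 E E2 E1E EE12; rewrite setUACA.
  by apply: setUSS; [apply: Wc|apply: Wfc].
have := idealres_sum (IH _ _ D'N Wc) (IH _ _ D'N Wfc).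
rewrite D'N DN.
have andE (p : mpoly R m) : mideal (label_dvd D' W) p /\ mideal (label_dvd D' Wf) p <->
  mideal (label_dvd D' (fun E => W E :|: Wf E)) p.
  split=> [[I1 I2] e pe|Ip]; last first.
    by split; apply: mideal_sub Ip => e /label_dvdP[E ED];
       rewrite mset_dvdU => /andP[W1 W2]; apply/label_dvdP; exists E.
  have /label_dvdP[E1 E1D W1] := I1 _ pe; have /label_dvdP[E2 E2D W2] := I2 _ pe.
  (* Both [E1 :|: E2] and [f |: (E1 :|: E2)] lie between [E1] and [E1 :|: (f |: E2)], so convexity
     bounds their labels by [W E1 :|: Wf E2]. *)
  apply/label_dvdP; exists (E1 :|: E2); first by rewrite subUset E1D.
  have W12 : mset_dvd (W E1 :|: Wf E2) e by rewrite mset_dvdU W1.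
  rewrite mset_dvdU; apply/andP; split; apply: mset_dvd_sub W12; apply: Wc.
  - exact: subsetUl.
  - by apply: setUS; apply: subsetUr.
  - by rewrite setUCA subsetUl.
  - by rewrite setUCA.
have := IH _ _ D'N Wlc; rewrite D'N => /(idealres_eq (fun p => iff_sym (andE p))).
move=> res /(_ res){res}.
apply: idealres_eq => p; rewrite -mideal_or; last exact: label_dvd_local.
split; apply: mideal_sub => e.
  case/orP=> /label_dvdP[E ED We]; apply/label_dvdP.
    by exists E => //; apply: subset_trans ED (subD1set _ _).
  exists (f |: E) => //; rewrite subUset sub1set fD.
  by apply: subset_trans ED (subD1set _ _).
move=> /label_dvdP[E ED We]; have [fE|fE] := boolP (f \in E); apply/orP; [right|left].
  apply/label_dvdP; exists (E :\ f); first exact: setSD.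
  by rewrite /Wf setD1K.
by apply/label_dvdP; exists E => //; rewrite subsetD1 ED.
Qed.

(** * The ideal of a class of Boolean functions as a monomial ideal *)

Lemma ideal_gen_mideal (T : finType) (R : comNzRingType) m (P : pred T)
    (W : T -> {set 'I_m}) (p : mpoly R m) :
  ideal_gen P (fun t => mmonom R (W t)) p <->
  mideal (fun e => [exists t, P t && mset_dvd (W t) e]) p.
Proof.
set G := ideal_gen _ _.
have GD p1 p2 : G p1 -> G p2 -> G (p1 + p2).
  move=> [c1 ->] [c2 ->]; exists (fun t => c1 t + c2 t).
  by rewrite -big_split; apply: eq_bigr => t _; rewrite mulrDl.
have G1 t q : P t -> G (mmonom R (W t) * q).
  move=> Pt; exists (fun t' => if t' == t then q else 0).
  rewrite (bigD1 t) //= eqxx big1 ?addr0 1?mulrC // => t' /andP[_ /negPf ->].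
  by rewrite mul0r.
have G0 : G 0 by exists (fun=> 0); rewrite big1 // => t _; rewrite mul0r.
split=> [[c ->]|].
  elim/big_ind: _; [exact: mideal0|exact: midealD|move=> t Pt].
  have: mideal (mset_dvd (W t)) (c t * mmonom R (W t)).
    by apply/mideal_mmonom; exists (c t); rewrite mulrC.
  by apply: mideal_sub => e We; apply/exists_inP; exists t.
(* Induction on a list of generators: the terms divisible by the head generator are split off by
   [mideal_or]. *)
suff H s q : all P s -> mideal (fun e => has (fun t => mset_dvd (W t) e) s) q -> G q.
  move=> Ip; apply: (H (enum P)).
    by apply/allP => t; rewrite mem_enum.
  apply: mideal_sub Ip => e /exists_inP[t Pt We]; apply/hasP; exists t => //.
  by rewrite mem_enum.
elim: s q => [|t s IH] q /=.
  move=> _ Iq; rewrite (_ : q = 0) //; apply: mcoefP => e; rewrite mcoef0.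
  by apply/eqP/negPn/negP => /Iq.
move=> /andP[Pt Ps] /mideal_or[|p1 [p2 [/mideal_mmonom[q1 ->] I2 ->]]].
  exact: mset_dvd_local.
by apply: GD; [apply: G1|apply: IH].
Qed.

Lemma vidx_subproof d (i : cube d) (b : bool) : (2 * enum_rank i + b < nvars d)%N.
Proof.
apply: (@leq_trans (2 * (enum_rank i).+1)); last by rewrite leq_mul2l ltn_ord.
by rewrite mulnS -addn1 [(2 + _)%N]addnC -addnA leq_add2l addn1; case: b.
Qed.

Definition vidx d (i : cube d) (b : bool) : 'I_(nvars d) := Ordinal (vidx_subproof i b).

Arguments vidx : simpl never.

Lemma vidx_inj d (i j : cube d) b c :
  vidx i b = vidx j c :> nat -> i = j /\ b = c.
Proof.
move=> /= E; have bc : b = c by case: b c E => -[] //; lia.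
by split=> //; apply/enum_rank_inj/val_inj => /=; move: E; rewrite bc; lia.
Qed.

Definition graph_vars d (f : boolfun d) : {set 'I_(nvars d)} :=
  [set vidx i (~~ f i) | i : cube d].

Lemma monomE (k : fieldType) d (f : boolfun d) : monom k f = mmonom k (graph_vars f).
Proof. by rewrite /mmonom big_imset //= => i j _ _ /(congr1 val)/vidx_inj[]. Qed.

Lemma IstarP (k : fieldType) d (C : {set boolfun d}) p :
  Istar k C p <-> mideal (fun e => [exists f in C, mset_dvd (graph_vars f) e]) p.
Proof.
rewrite -(ideal_gen_mideal (mem C) (@graph_vars d)).
by split=> -[c ->]; exists c; apply: eq_bigr => f _; rewrite monomE.
Qed.

(** At a point where the conjunction of [E] is 1, so is that of the smaller [E1]. Where it is 0,
    some [g] in [E] vanishes, and [g] lies in [E1] or [E2], whose conjunction is then 0 as well. *)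
Lemma graph_vars_convex d : convex_label (fun E => graph_vars (@conj_of d E)).
Proof.
move=> E1 E E2 /subsetP E1E /subsetP EE12; apply/subsetP => _ /imsetP[i _ ->].
have sub (f : boolfun d) : conj_of E i = f i -> vidx i (~~ conj_of E i) \in graph_vars f.
  by move=> ->; apply/imsetP; exists i.
rewrite inE; case Ei: (conj_of E i).
  apply/orP; left; rewrite -Ei; apply: sub; rewrite Ei; apply/esym.
  move: Ei; rewrite !ffunE => /forall_inP EP.
  by apply/forall_inP => g /E1E; apply: EP.
move: (Ei); rewrite ffunE => /negbT; rewrite negb_forall => /existsP[g].
rewrite negb_imply => /andP[/EE12 gE12 /negPf gi].
have no (E' : {set boolfun d}) : g \in E' -> conj_of E i = conj_of E' i.
  move=> gE'; rewrite Ei; apply/esym/negP; rewrite ffunE => /forall_inP/(_ _ gE').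
  by rewrite gi.
move: gE12; rewrite inE -Ei => /orP[] /no /sub ->; rewrite ?orbT //.
Qed.

Lemma idealres_CSP (k : fieldType) d (D : {set boolfun d}) :
  idealres #|D| (Istar k (CSP D)).
Proof.
apply: (idealres_eq _ (idealres_label _ D (@graph_vars_convex d))) => p.
rewrite IstarP; split; apply: mideal_sub => e.
  move=> /label_dvdP[E ED We]; apply/exists_inP; exists (conj_of E) => //.
  by rewrite inE; apply/exists_inP; exists E.
move=> /exists_inP[f]; rewrite inE => /exists_inP[E ED /eqP ->] We.
by apply/label_dvdP; exists E.
Qed.

(** * Minimal resolutions and the lower bound *)

(** A substitute for minimal resolutions: [eps] plays the part of reduction modulo the maximal
    ideal, and [0 < m] says that the last module is nonzero. *)
Fixpoint tight (R S : comNzRingType) (eps : {rmorphism R -> S}) N m n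
    (A : 'M[R]_(m, n)) : Prop :=
  if N is N'.+1 then
    exists p (B : 'M[R]_(p, m)),
      [/\ exact_mx B A, map_mx eps B = 0 & tight eps N' B]
  else mx_inj A /\ (0 < m)%N.

Lemma tight_ker (R S : comNzRingType) (eps : {rmorphism R -> S}) N m n n'
    (A : 'M[R]_(m, n)) (A' : 'M[R]_(m, n')) :
  (forall v : 'rV_m, v *m A = 0 <-> v *m A' = 0) -> tight eps N A -> tight eps N A'.
Proof.
move=> AA'; case: N => [|N] /=; first by move=> [Ai m0]; split=> // v /AA'/Ai.
by move=> [p [B [BA B0 Bt]]]; exists p, B; split=> // v; rewrite -AA'.
Qed.

(* The comparison maps [alpha], [beta] between the two resolutions and the
   homotopy [h] from [c] to [alpha beta] are propagated along the resolutions. *)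
Lemma tight_compare (R S : comNzRingType) (eps : {rmorphism R -> S}) L m n m' n'
    (A : 'M[R]_(m, n)) (A' : 'M[R]_(m', n')) c alpha beta h :
  tight eps L.+1 A -> resolvable L A' ->
  (forall v : 'rV_m, v *m A = 0 -> v *m alpha *m A' = 0) ->
  (forall v : 'rV_m', v *m A' = 0 -> v *m beta *m A = 0) ->
  (c%:M - alpha *m beta - A *m h) *m A = 0 ->
  eps c = 0.
Proof.
elim: L m n m' n' A A' alpha beta h => [|L IH] m n m' n' A A' alpha beta h;
  rewrite -/(tight eps _.+1); move=> [p [B [BA B0 Bt]]] A'res aP bP hP;
  have [h2 h2E] := exact_lift BA hP.
  move: Bt => [Bi p0].
  (* Here [A'] is injective, so [B *m alpha] vanishes and the homotopy alone gives [c%:M = B *m h2],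
     whose entries [eps] kills; [0 < p] provides a diagonal entry. *)
  have Ba : B *m alpha = 0.
    by apply: (mx_inj_mul0 A'res); apply/row_matrixP => i;
       rewrite !row_mul row0; apply: aP; rewrite -row_mul (exact_mul0 BA) row0.
  have /(mx_inj_mul0 Bi)/eqP : (c%:M - B *m h2) *m B = 0.
    rewrite mulmxBl -mulmxA -h2E !mulmxBr !mulmxA Ba (exact_mul0 BA) !mul0mx !subr0.
    by rewrite scalar_mxC subrr.
  rewrite subr_eq0 => /eqP/(congr1 (map_mx eps)).
  rewrite map_mxM B0 mul0mx map_scalar_mx => /matrixP/(_ (Ordinal p0) (Ordinal p0)).
  by rewrite !mxE eqxx mulr1n.
move: A'res => [p' [B' [BA' B'res]]].
have [a2 a2E] : exists X, B *m alpha = X *m B'.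
  apply: lift_rows => i; apply/BA'; rewrite row_mul; apply: aP.
  by rewrite -row_mul (exact_mul0 BA) row0.
have [b2 b2E] : exists X, B' *m beta = X *m B.
  apply: lift_rows => i; apply/BA; rewrite row_mul; apply: bP.
  by rewrite -row_mul (exact_mul0 BA') row0.
apply: (IH _ _ _ _ B B' a2 b2 h2) => //.
- by move=> v vB; rewrite -mulmxA -a2E mulmxA vB mul0mx.
- by move=> v vB; rewrite -mulmxA -b2E mulmxA vB mul0mx.
rewrite !mulmxBl -(mulmxA B) -h2E !mulmxBr !mulmxA (exact_mul0 BA) mul0mx subr0.
rewrite a2E -(mulmxA a2 B') b2E mulmxA -scalar_mxC.
by rewrite opprB addrA subrK addrN.
Qed.

(** A differential of the tensor product of a complex with [R -> R^2], [1 |-> (y, -x)], the Koszul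
    resolution of the ideal [(x, y)] for a regular sequence. *)
Definition koszul_mx (R : comNzRingType) p2 p q (P2 : 'M[R]_(p2, p)) (P : 'M[R]_(p, q))
    (x y : R) :=
  block_mx (block_mx P2 0 0 P2) 0 (row_mx y%:M (- x)%:M) P.

Lemma tight_koszul (R S : comNzRingType) (eps : {rmorphism R -> S}) N p q
    (P : 'M[R]_(p, q)) x y :
  eps x = 0 -> eps y = 0 -> tight eps N P ->
  exists p2 (P2 : 'M[R]_(p2, p)),
    [/\ exact_mx P2 P, map_mx eps P2 = 0 & tight eps N (koszul_mx P2 P x y)].
Proof.
elim: N p q P x y => [|N IH] p q P x y x0 y0.
  move=> [Pi p0]; exists 0%N, 0; split; [exact: exact_inj|by rewrite map_mx0|].
  split; last by rewrite addn_gt0 p0 orbT.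
  move=> v; rewrite -[v]hsubmxK mul_row_block mulmx0 add0r => /eqP.
  rewrite row_mx_eq0 => /andP[_ /eqP/Pi ->].
  by rewrite (_ : lsubmx v = 0) ?row_mx0 //; apply/matrixP => i [].
move=> [p2 [P2 [PE P20 P2t]]]; exists p2, P2; split=> //.
(* The signs of [x] and [y] alternate along the complex to make consecutive squares anticommute. *)
have [||p3 [P3 [P2E P30 P3t]]] := IH _ _ P2 (- x) (- y) _ _ P2t.
- by rewrite rmorphN x0 oppr0.
- by rewrite rmorphN y0 oppr0.
exists (p3 + p3 + p2)%N, (koszul_mx P3 P2 (- x) (- y)); split=> //.
  apply: cone_exact => //; first exact: exact_diag.
  rewrite mul_row_block !mulmx0 add0r addr0 mul_mx_row add_row_mx.
  rewrite -!scalar_mxC -!mulmxDr -!(raddfD (@scalar_mx _ p)) opprK addNr subrr.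
by rewrite raddf0 mulmx0 row_mx0.
rewrite !map_block_mx map_row_mx !map_scalar_mx P30 P20 !map_mx0 !rmorphN x0 y0.
by rewrite !raddf0 row_mx0 !block_mx0.
Qed.

(** The hypotheses say that [0 -> I -> I^2 -> I' -> 0], with maps [(y, -x)] and [(x, y)], is exact;
    the cone of the first map resolves [I'] with one more step. *)
Lemma tight_ideal_step (R S : comNzRingType) (eps : {rmorphism R -> S}) N m
    (A : 'M[R]_(m, 1)) (I I' : R -> Prop) x y :
  eps x = 0 -> eps y = 0 -> mx_spans I A -> tight eps N A ->
  (forall z, y * z = 0 -> z = 0) ->
  (forall u v, I u -> I v -> x * u + y * v = 0 ->
    exists w, [/\ I w, u = y * w & v = - (x * w)]) ->
  (forall p, I' p <-> exists u v, [/\ I u, I v & p = x * u + y * v]) ->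
  exists m' (A' : 'M[R]_(m', 1)), mx_spans I' A' /\ tight eps N.+1 A'.
Proof.
move=> x0 y0 IA /(tight_koszul x0 y0)[p2 [P2 [PE P20 Pt]]] yreg xy I'E.
have inI (v : 'rV_m) : I ((v *m A) ord0 ord0) by apply/IA; exists v; apply/mx11P.
exists (m + m)%N, (col_mx (x *: A) (y *: A)); split.
  move=> p; rewrite I'E; split.
    move=> [u [v [/IA[a aE] /IA[b bE] ->]]]; exists (row_mx a b).
    by rewrite mul_row_col -!scalemxAr aE bE !scale_scalar_mx raddfD.
  move=> [v]; rewrite -[v]hsubmxK mul_row_col -!scalemxAr => /mx11P vE.
  exists ((lsubmx v *m A) ord0 ord0), ((rsubmx v *m A) ord0 ord0); split=> //.
  by rewrite -vE !mxE.
exists (p2 + p2 + m)%N, (col_mx (block_mx P2 0 0 P2) (row_mx y%:M (- x)%:M)).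
split.
- move=> v; rewrite -[v]hsubmxK; set a := lsubmx v; set b := rsubmx v.
  rewrite mul_row_col -!scalemxAr; split.
    move=> /matrixP/(_ ord0 ord0); rewrite [LHS]mxE [RHS]mxE.
    rewrite [X in X + _ = _]mxE [X in _ + X = _]mxE.
    case/(xy _ _ (inI a) (inI b)) => w [/IA[c cE] /mx11P aE /mx11P bE].
    have /PE[a' a'E] : (a - y *: c) *m A = 0.
      by rewrite mulmxBl -scalemxAl cE aE scale_scalar_mx subrr.
    have /PE[b' b'E] : (b + x *: c) *m A = 0.
      by rewrite mulmxDl -scalemxAl cE bE scale_scalar_mx -raddfD /= addNr raddf0.
    exists (row_mx (row_mx a' b') c); rewrite mul_row_col mul_row_block.
    rewrite !mulmx0 addr0 add0r mul_mx_row add_row_mx -a'E -b'E !mul_mx_scalar.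
    by rewrite subrK scaleNr addrK.
  move=> [w]; rewrite -[w]hsubmxK -[lsubmx w]hsubmxK mul_row_col mul_row_block.
  rewrite !mulmx0 addr0 add0r mul_mx_row add_row_mx !mul_mx_scalar.
  move=> /eq_row_mx[-> ->]; rewrite !mulmxDl -!mulmxA (exact_mul0 PE) !mulmx0 !add0r.
  by rewrite -!scalemxAl !scalerA mulrN scaleNr mulrC subrr.
- rewrite map_col_mx map_block_mx map_row_mx !map_scalar_mx P20 !map_mx0 !rmorphN x0 y0.
  by rewrite !raddf0 row_mx0 block_mx0 col_mx0.
(* The block column [(0, A)] leaves the kernel unchanged: multiplication by [col_mx A 0] gives [y]
   times the image under [A] of the last block, and [y] is regular. *)
apply: tight_ker Pt => v; rewrite /koszul_mx block_mxEh mul_mx_row; split.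
  by move=> /eqP; rewrite row_mx_eq0 => /andP[/eqP].
move=> vQ; rewrite vQ; apply/eqP; rewrite row_mx_eq0 eqxx /=; apply/eqP.
move: vQ; rewrite -[v]hsubmxK !mul_row_col mulmx0 add0r.
move=> /(congr1 (mulmx^~ (col_mx A 0))) /=.
rewrite mul0mx mulmxDl -!mulmxA mul_block_col mul_row_col (exact_mul0 PE).
rewrite !mulmx0 !mul0mx !addr0 col_mx0 mulmx0 add0r mul_scalar_mx -scalemxAr.
move=> /matrixP/(_ ord0 ord0); rewrite [LHS]mxE [RHS]mxE => /yreg vA.
by apply/matrixP => i j; rewrite !ord1 vA mxE.
Qed.

(** Exponents in the intersection of the ideals [(x_a, x_b)], which is also their product when the
    pairs are disjoint. *)
Definition hits_pairs (s : seq (nat * nat)) (e : nat -> nat) :=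
  all (fun ab => (0 < e ab.1) || (0 < e ab.2))%N s.

Definition pair_vars (s : seq (nat * nat)) := flatten [seq [:: ab.1; ab.2] | ab <- s].

Lemma hits_pairs_ext s e e' : (forall i, i \in pair_vars s -> e i = e' i) ->
  hits_pairs s e = hits_pairs s e'.
Proof.
move=> ee'; apply: eq_in_all => ab abs; rewrite !ee' //;
  by apply/flatten_mapP; exists ab; rewrite // !inE eqxx ?orbT.
Qed.

Lemma mideal_hits_mul (R : comNzRingType) m s i (p : mpoly R m) :
  (i < m)%N -> i \notin pair_vars s -> mideal (hits_pairs s) p ->
  mideal (fun e => (0 < e i)%N && hits_pairs s e) (mvar R m i * p).
Proof.
move=> im is_ Ip e; rewrite mcoefX //; case: ifP => [ei|]; last by rewrite eqxx.
move=> /Ip; rewrite (@hits_pairs_ext _ _ e) // => j js.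
by case: eqP js is_ => [-> ->|_ _ _] //; rewrite subn0.
Qed.

Lemma mideal_hits_div (R : comNzRingType) m s i (p : mpoly R m) :
  (i < m)%N -> i \notin pair_vars s -> mideal (hits_pairs s) p ->
  mideal (hits_pairs s) (mdiv i p).
Proof.
move=> im is_ Ip e; rewrite mcoef_div //.
move=> /Ip; rewrite (@hits_pairs_ext _ _ e) // => j js.
by case: eqP js is_ => [-> ->|_ _ _] //; rewrite addn0.
Qed.

Lemma tight_pairs (R S : comNzRingType) m (eps : {rmorphism mpoly R m -> S})
    (s : seq (nat * nat)) :
  uniq (pair_vars s) -> (forall i, i \in pair_vars s -> (i < m)%N) ->
  (forall i, i \in pair_vars s -> eps (mvar R m i) = 0) ->
  exists m' (A : 'M[mpoly R m]_(m', 1)),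
    mx_spans (mideal (hits_pairs s)) A /\ tight eps (size s) A.
Proof.
elim: s => [|[a b] s IH] /=.
  move=> _ _ _; exists 1%N, 1%:M; split; last by split=> // v; rewrite mulmx1.
  by move=> x; split=> // _; exists x%:M; rewrite mulmx1.
rewrite -/(pair_vars s) inE negb_or -andbA => /and4P[ab as_ bs us] sm s0.
have [||m' [A [IA At]]] := IH us.
- by move=> i is_; apply: sm; rewrite !inE is_ !orbT.
- by move=> i is_; apply: s0; rewrite !inE is_ !orbT.
have am : (a < m)%N by apply: sm; rewrite !inE eqxx.
have bm : (b < m)%N by apply: sm; rewrite !inE eqxx orbT.
have localQ : local_pred m (fun e => (0 < e a)%N && hits_pairs s e).
  move=> e e' ee'; rewrite ee' //; congr (_ && _); apply: hits_pairs_ext => i is_.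
  by apply/ee'/sm; rewrite !inE is_ !orbT.
have QE e : hits_pairs ((a, b) :: s) e =
    ((0 < e a)%N && hits_pairs s e) || ((0 < e b)%N && hits_pairs s e).
  by rewrite /= -andb_orl.
apply: (tight_ideal_step (x := mvar R m a) (y := mvar R m b) _ _ IA At).
- by apply: s0; rewrite !inE eqxx.
- by apply: s0; rewrite !inE eqxx orbT.
- by move=> z; apply: mvar_reg.
- move=> u v Iu Iv uv; have uE : u = mvar R m b * mdiv b u.
    apply: mdivK => // e ue.
    (* Compare coefficients at [e] raised by one in [a]: if [e b] were 0, the second summand would
       contribute nothing and the coefficient of [u] at [e] would vanish. *)
    have /eqP := congr1 (fun p => mcoef p (fun j => e j + (j == a))%N) uv.
    rewrite mcoefD mcoef0 !mcoefX // eqxx addn1 /= [b == a]eq_sym (negPf ab) addn0.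
    case: ifP => //; rewrite addr0 (@mcoef_ext _ _ u _ e) ?(negPf ue) // => j _.
    by rewrite addnK.
  exists (mdiv b u); split=> //; first exact: mideal_hits_div.
  apply/eqP; rewrite -addr_eq0; apply/eqP/(@mvar_reg _ _ b) => //.
  by rewrite mulrDr mulrCA -uE addrC.
move=> p; split=> [Ip|[u [v [Iu Iv ->]]]]; last first.
  apply: midealD.
    by apply: mideal_sub (mideal_hits_mul am as_ Iu) => e; rewrite QE => ->.
  by apply: mideal_sub (mideal_hits_mul bm bs Iv) => e; rewrite QE => ->; rewrite orbT.
have : mideal (fun e => (0 < e a) && hits_pairs s e || (0 < e b) && hits_pairs s e)%N p.
  by apply: mideal_sub Ip => e; rewrite QE.
move=> /(mideal_or _ _ localQ)[p1 [p2 [I1 I2 pE]]].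
(* The terms of [p1] contain variable [a], those of [p2] variable [b]; dividing by a variable
   outside [s] preserves [hits_pairs s]. *)
exists (mdiv a p1), (mdiv b p2); split.
- by apply: mideal_hits_div => //; apply: mideal_sub I1 => e /andP[].
- by apply: mideal_hits_div => //; apply: mideal_sub I2 => e /andP[].
by rewrite -!mdivK // => e; [move=> /I2/andP[]|move=> /I1/andP[]].
Qed.

(** * Evaluation and the comparison for a shattered set *)

Lemma meval_exists (R : comNzRingType) m (nu : nat -> R) :
  exists f : {rmorphism mpoly R m -> R}, forall i, (i < m)%N -> f (mvar R m i) = nu i.
Proof.
elim: m => [|m [f fE]]; first by exists idfun.
have cfu : commr_rmorph f (nu m) by move=> x; apply: mulrC.
exists (horner_morph cfu) => i; rewrite ltnS leq_eqVlt /=.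
case: eqP => [-> _|_ /= im]; first exact: horner_morphX.
by rewrite [LHS]horner_morphC fE.
Qed.


Lemma shattered_projdim (k : fieldType) d (C : {set boolfun d}) (U : {set cube d}) L :
  shattered C U -> projdim_le (Istar k C) L -> (#|U| <= L)%N.
Proof.
move=> /forallP CU /projdim_resolvable[m' [A' [IA' A'res]]].
case UN: #|U| => [|N] //; rewrite leqNgt; apply/negP => LN.
have {}A'res : resolvable N A' by apply: resolvable_leq A'res; rewrite -ltnS.
pose s := [seq (val (vidx u false), val (vidx u true)) | u <- enum U].
have sE : pair_vars s = [seq val (vidx u b) | u <- enum U, b <- [:: false; true]].
  by rewrite /pair_vars -map_comp.
have sP (j : nat) : reflect (exists u b, u \in U /\ j = val (vidx u b)) (j \in pair_vars s).
  rewrite sE; apply: (iffP allpairsP) => [[[u b] /= [uU _ ->]]|[u [b [uU ->]]]].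
    by exists u, b; rewrite mem_enum in uU.
  by exists (u, b); rewrite mem_enum; split=> //; case: b.
have us : uniq (pair_vars s).
  rewrite sE; apply: allpairs_uniq; rewrite ?enum_uniq //.
  by move=> [u b] [u' b'] _ _ /= /vidx_inj[-> ->].
have sm i : i \in pair_vars s -> (i < nvars d)%N.
  by move=> /sP[u [b [_ ->]]]; apply: ltn_ord.
have [eps epsE] := meval_exists (nvars d) (fun j => if j \in pair_vars s then 0 else 1 : k).
have s0 i : i \in pair_vars s -> eps (mvar k (nvars d) i) = 0.
  by move=> is_; rewrite epsE ?is_ ?sm.
have [m [A [JA At]]] := tight_pairs us sm s0.
rewrite size_map -cardE UN in At.
pose Y := [set j : 'I_(nvars d) | val j \notin pair_vars s].
pose c := mmonom k Y.
have IJ p : Istar k C p -> mideal (hits_pairs s) p.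
  move=> /IstarP; apply: mideal_sub => e /exists_inP[f _ /mset_dvdP fe].
  apply/allP => _ /mapP[u _ ->] /=; have := fe (vidx u (~~ f u)) (imset_f _ _).
  by case: (f u) => /= ->; rewrite ?orbT.
have cJI p : mideal (hits_pairs s) p -> Istar k C (c * p).
  move=> Jp; apply/IstarP => e.
  rewrite /c mmonomE mcoef_prod ?enum_val_uniq //; last exact: enum_val_lt.
  rewrite -mset_dvdE; case: ifP => [/mset_dvdP Ye|_]; last by rewrite eqxx.
  move=> /Jp/allP Je.
  (* The pattern is read off [e]: on [U], [f u] is false exactly when [x_(u,1)] occurs, so
     [x_(u,1-f(u))] always occurs. *)
  have /exists_inP[f fC /forall_inP fU] :=
    CU [ffun u => ~~ (0 < e (vidx u true))%N].
  apply/exists_inP; exists f => //; apply/mset_dvdP => _ /imsetP[u _ ->].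
  have [uU|uU] := boolP (u \in U); last first.
    (* Outside [U] the factor [c] supplies the variable. *)
    apply: Ye; rewrite inE; apply/sP => -[u' [b' [u'U /vidx_inj[uu' _]]]].
    by rewrite uu' u'U in uU.
  rewrite (eqP (fU u uU)) ffunE negbK; case E: (0 < e (vidx u true))%N => //.
  have us' : u \in enum U by rewrite mem_enum.
  have := Je _ (map_f _ us'); case/orP => /= e0.
    exact: leq_trans e0 (leq_subr _ _).
  by move: (leq_trans e0 (leq_subr _ _)); rewrite E.
have [beta bE] := spans_lift IA' JA IJ.
have [alpha aE] : exists X, c *: A = X *m A'.
  apply: (@spans_lift _ (fun p => exists2 q, mideal (hits_pairs s) q & p = c * q) _ _ _ _ _ _ IA').
    move=> x; split.
      move=> [q /JA[v vE] ->]; exists v.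
      by rewrite -scalemxAr vE scale_scalar_mx.
    move=> [v]; rewrite -scalemxAr => /mx11P; rewrite mxE => <-.
    by exists ((v *m A) ord0 ord0) => //; apply/JA; exists v; apply/mx11P.
  by move=> x [q Jq ->]; apply: cJI.
have : eps c = 0.
  (* The initial homotopy is 0 because [c *: A = alpha *m beta *m A] holds exactly. *)
  apply: (tight_compare (alpha := alpha) (beta := beta) (h := 0) At A'res).
  - by move=> v vA; rewrite -mulmxA -aE -scalemxAr vA scaler0.
  - by move=> v vA; rewrite -mulmxA -bE.
  by rewrite mulmx0 subr0 mulmxBl -mulmxA -bE -aE mul_scalar_mx subrr.
rewrite /c rmorph_prod big1 => [/eqP|j]; first by rewrite oner_eq0.
by rewrite inE => /negPf js; rewrite epsE ?js.
Qed.

Local Close Scope ring_scope.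

Theorem mainTheorem14 (k : fieldType) (d : nat) (D : {set boolfun d}) :
  projdim_le (Istar k (CSP D)) #|D| /\
  (forall L : nat, projdim_le (Istar k (CSP D)) L -> dimVC (CSP D) <= L).
Proof.
split; first by apply/projdim_resolvable; apply: idealres_CSP.
move=> L CL; apply/bigmax_leqP => U CU.
exact: shattered_projdim CU CL.
Qed.
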